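(* Let $\mathbb T=\mathbb R/(2\pi\mathbb Z)$, and let $\mathcal R_{\boldsymbol X}$, $\breve\Lambda_{\boldsymbol X}=2\mathcal W_0+\mathcal R_{\boldsymbol X}$ be the remainder operators and parametrized Dirichlet-to-Neumann maps. Let $\Theta_{r,J}$ be (the parameter set of) a class of low-rank DeepONets $\mathcal N_\theta$, and let $\mu$ be a probability distribution of pairs $(f,\boldsymbol X)$ of boundary data and geometries. For samples $(f_i,\boldsymbol X_i)$, $i=1,\dots,N$, set $$\mathcal L_{\rm pop}(\theta)=\mathbb E_{(f,\boldsymbol X)\sim\mu}\|\mathcal N_\theta(f,\boldsymbol X)-\mathcal R_{\boldsymbol X}f\|_{L^2(\mathbb T)}^2,\qquad \mathcal L_{\rm emp}(\theta)=\frac1N\sum_{i=1}^N\|\mathcal N_\theta(f_i,\boldsymbol X_i)-\mathcal R_{\boldsymbol X_i}f_i\|_{L^2(\mathbb T)}^2,$$ $$\Delta_N=\sup_{\theta\in\Theta_{r,J}}|\mathcal L_{\rm pop}(\theta)-\mathcal L_{\rm emp}(\theta)|.$$ Suppose $\widehat\theta\in\Theta_{r,J}$ satisfies $\mathcal L_{\rm emp}(\widehat\theta)\le\inf_{\theta\in\Theta_{r,J}}\mathcal L_{\rm emp}(\theta)+\eta_{\rm opt}$ with $\eta_{\rm opt}\ge0$, and suppose there is $\theta^\star\in\Theta_{r,J}$ and a number $E_{\rm det}(r,J)\ge0$ with $$\sup_{(f,\boldsymbol X)\in\operatorname{supp}\mu}\|\mathcal R_{\boldsymbol X}f-\mathcal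 N_{\theta^\star}(f,\boldsymbol X)\|_{L^2(\mathbb T)}\le E_{\rm det}(r,J).$$ Then: (i) $\mathcal L_{\rm pop}(\widehat\theta)^{1/2}\le E_{\rm det}(r,J)+\sqrt{2\Delta_N}+\sqrt{\eta_{\rm opt}}.$ (ii) If $\widehat\Lambda_{\boldsymbol X}f:=2\mathcal W_0f+\mathcal N_{\widehat\theta}(f,\boldsymbol X)$, then $$\Big(\mathbb E_{(f,\boldsymbol X)\sim\mu}\|\breve\Lambda_{\boldsymbol X}f-\widehat\Lambda_{\boldsymbol X}f\|_{L^2(\mathbb T)}^2\Big)^{1/2}\le E_{\rm det}(r,J)+\sqrt{2\Delta_N}+\sqrt{\eta_{\rm opt}}.$$ (iii) If instead $\widehat\Lambda_{\boldsymbol X}f:=2\mathcal W_0^{(K)}f+\mathcal N_{\widehat\theta}(f,\boldsymbol X)$ with $\mathcal W_0^{(K)}$ the Fourier truncation of $\mathcal W_0$, the bound in (ii) holds with the additional term $\big(\mathbb E_{(f,\boldsymbol X)\sim\mu}\|2\mathcal W_0f-2\mathcal W_0^{(K)}f\|_{L^2(\mathbb T)}^2\big)^{1/2}$ on the right-hand side. (iv) Suppose in addition that the finite-node assumptions hold with $\mathcal N_{\theta^\star}$ as the point-value DeepONet (see context). Then the deterministic error may be taken to satisfy $$E_{\rm det}(r,J)\le C\big(E_{\rm rank}(r)+E_{\rm geom}(J)+E_{\rm quad}(r,J)+E_{\rm net}(r,J)\big),$$ with $C$ depending only on $|\mathbb T|$ and on the bound $B$ for the input norm, where $E_{\rm rank}(r)=O(r^{-m})$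 is the rank error, $E_{\rm geom}(J)$ the geometry reconstruction error, $E_{\rm quad}(r,J)$ the input quadrature error and $E_{\rm net}(r,J)$ the neural realization error, as given explicitly in the context.
   Context: Admissible curves: for an integer $n\ge2$ and constants $M,c_0,c_1>0$, $\mathcal A_n(M,c_0,c_1)$ is the set of $\boldsymbol X\in C^n(\mathbb T;\mathbb R^2)$ with $\|\boldsymbol X\|_{C^n(\mathbb T)}\le M$, $|\boldsymbol X'(s)|\ge c_0$ and $|\boldsymbol X(s)-\boldsymbol X(t)|\ge c_1|2\sin\frac{s-t}2|$ for all $s,t$. Geometries in $\mu$ and in the samples belong to $\mathcal A_n(M,c_0,c_1)$. For such $\boldsymbol X$, let $\Omega$ be the bounded domain enclosed by $\boldsymbol X(\mathbb T)$; for $f$ on $\mathbb T$ let $u$ solve $\Delta u=0$ in $\Omega$, $u\circ\boldsymbol X=f$, and put $\breve\Lambda_{\boldsymbol X}f=(\partial_{\boldsymbol n}u\circ\boldsymbol X)|\boldsymbol X'|$ ($\boldsymbol n$ outward unit normal). $\mathcal W_0$ is the Fourier multiplier with symbol $|k|/2$, $\mathcal W_0^{(K)}$ its truncation to finitely many modes $|k|\le K$, and $\mathcal R_{\boldsymbol X}=\breve\Lambda_{\boldsymbol X}-2\mathcal W_0$. Admissible remainder family (on a class $\mathcal A$ of curves): with integers $m\ge1$, $0\le\mu_0\le m$, $0\le\nu<n$, one has $\mathcal R_{\boldsymbol X}f(s)=\int_{\mathbb T}R(s,t;\boldsymbol X)f(t)\,dt$ for $\boldsymbol X\in\mathcal A$,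 with $\sup_{\boldsymbol X\in\mathcal A}\|R(\cdot,\cdot;\boldsymbol X)\|_{C^m(\mathbb T^2)}\le M_R$ and $\|R(\cdot,\cdot;\boldsymbol X)-R(\cdot,\cdot;\boldsymbol Y)\|_{C^{\mu_0}(\mathbb T^2)}\le L_R\|\boldsymbol X-\boldsymbol Y\|_{C^\nu(\mathbb T)}$ for $\boldsymbol X,\boldsymbol Y\in\mathcal A$. Low-rank DeepONet: a map $\mathcal N_\theta(f,\boldsymbol X)(s)=\sum_{k=1}^r\tau_k(s)\rho_k(f;Z_J(\boldsymbol X))$, with trunk outputs $\tau_k$, branch outputs $\rho_k$ (both depending on the parameter $\theta$), and $Z_J(\boldsymbol X)=(\boldsymbol X(s_0),\dots,\boldsymbol X(s_{J-1}))\in(\mathbb R^2)^J$, $s_j=2\pi j/J$. Finite-node assumptions used in (iv): (a) Remainder class: $\{\mathcal R_{\boldsymbol X}\}$ is an admissible remainder family on the enlarged class $\mathcal A_n(2M,c_0/2,c_1/2)$ as well as on $\mathcal A_n(M,c_0,c_1)$, with the same constants $M_R,L_R$. (b) Geometry reconstruction: there are a reconstruction operator $\Pi_J$ and constants $C_\Pi,J_0$ such that for all $\boldsymbol X\in\mathcal A_n(M,c_0,c_1)$ and $J\ge J_0$, $\boldsymbol X_J:=\Pi_JZ_J(\boldsymbol X)\in\mathcal A_n(2M,c_0/2,c_1/2)$ and $\|\boldsymbol X-\boldsymbol X_J\|_{C^\nu(\mathbb T)}\le C_\Pi J^{-(n-\nu)}\|\boldsymbol X\|_{C^n(\mathbb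 T)}$. (c) Quadrature: for some integer $q\ge0$ there are weights $\omega_j$ and a constant $C_Q$ with $|\int_{\mathbb T}g\,dt-\sum_{j=0}^{J-1}\omega_jg(s_j)|\le C_QJ^{-q}\|g\|_{C^q(\mathbb T)}$ for all $g\in C^q(\mathbb T)$. (d) Rank: $r\ge m$, $J\ge J_0$, and there are bounded trunk functions $a_k$ (independent of the geometry) and $b_k(\cdot;\boldsymbol X_J)\in C^q(\mathbb T)$ with $\|R(\cdot,\cdot;\boldsymbol X_J)-\sum_{k=1}^ra_k(s)b_k(t;\boldsymbol X_J)\|_{L^\infty(\mathbb T^2)}\le C_{{\rm ker},C^0}r^{-m}$. (e) Network: $\mathcal N_{\theta^\star}(f,\boldsymbol X)(s)=\sum_{k=1}^r\widehat a_k(s)\sum_{j=0}^{J-1}\omega_j\widehat b_k(s_j;Z_J(\boldsymbol X))f(s_j)$ with $\sup_s|a_k(s)-\widehat a_k(s)|\le\delta_k^a$ and $\sup_t|b_k(t;\boldsymbol X_J)-\widehat b_k(t;Z_J(\boldsymbol X))|\le\delta_k^b$. (f) Inputs: $f\in C^q(\mathbb T)$ with $\|f\|_{C^q(\mathbb T)}\le B$ on $\operatorname{supp}\mu$. Conditions (d) and (e) are required for all geometries $\boldsymbol X$ occurring in $\operatorname{supp}\mu$, with the same constants. The error terms are $E_{\rm geom}(J)=|\mathbb T|L_RC_\Pi MJ^{-(n-\nu)}$, $E_{\rm rank}(r)=|\mathbb T|C_{{\rm ker},C^0}r^{-m}$, $E_{\rm quad}(r,J)=\sup_{\boldsymbol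 X}C_QC_{\rm prod}(q)J^{-q}\sum_{k=1}^r\|a_k\|_{L^\infty}\|b_k(\cdot;\boldsymbol X_J)\|_{C^q}$, $E_{\rm net}(r,J)=\sup_{\boldsymbol X}C_\omega\sum_{k=1}^r\big(\|b_k(\cdot;\boldsymbol X_J)\|_{L^\infty}\delta_k^a+\|a_k\|_{L^\infty}\delta_k^b+\delta_k^a\delta_k^b\big)$, where the suprema are over geometries occurring in $\operatorname{supp}\mu$, $C_\omega=\sum_{j=0}^{J-1}|\omega_j|$, and $C_{\rm prod}(q)$ is any constant with $\|uv\|_{C^q}\le C_{\rm prod}(q)\|u\|_{C^q}\|v\|_{C^q}$ for all $u,v\in C^q(\mathbb T)$. *)

(* Defs.v *)
From HB Require Import structures.
From mathcomp Require Import all_boot all_order all_algebra.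
From mathcomp Require Import all_classical all_reals all_analysis.
From mathcomp Require Import measurable_realfun.

Set Implicit Arguments.
Unset Strict Implicit.
Unset Printing Implicit Defensive.

Import Order.TTheory GRing.Theory Num.Theory.
Import numFieldNormedType.Exports.

Local Open Scope classical_set_scope.
Local Open Scope ring_scope.

(* A function on the circle T = R / 2 pi Z is a 2 pi-periodic function on the
   line; integrals over T are integrals over [0, 2 pi]. *)
Section circle.
Context {R : realType}.
Implicit Types (f g : R -> R) (X Y : R -> R * R) (K : R -> R -> R).

Definition periodic (U : Type) (g : R -> U) : Prop :=
  forall s, g (s + 2 * pi) = g s.

Definition circ : set (measurableTypeR R) -> \bar R :=
  mrestr (@lebesgue_measure R) (measurable_itv `[0, 2 * pi]).

HB.instance Definition _ := Measure.on circ.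

Lemma circ_fin : fin_num_fun circ.
Proof.
move=> U mU; rewrite ge0_fin_numE ?measure_ge0//.
apply: (@le_lt_trans _ _ (@lebesgue_measure R `[0%R, (2 * pi)%R]%classic)).
  apply: le_measure; rewrite ?inE; [|exact: measurable_itv|exact: subIsetr].
  exact: measurableI.
by rewrite lebesgue_measure_itv /=; case: ifP => _; rewrite ?ltry.
Qed.

HB.instance Definition _ := Measure_isFinite.Build _ _ _ circ circ_fin.

Definition L2T : set (R -> R) :=
  [set g | periodic g /\ g \in Lfun circ 2%:E].

Definition L2norm g : \bar R := ('N[circ]_2%:E [EFin \o g])%E.

Definition Linf_norm g : \bar R := ('N[circ]_+oo [EFin \o g])%E.

Definition enorm (v : R * R) : R := Num.sqrt (v.1 ^+ 2 + v.2 ^+ 2).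

Definition CkT (V : normedModType R) (n : nat) (g : R -> V) : Prop :=
  [/\ periodic g,
      forall k, (k < n)%N -> forall s, derivable (derive1n k g) s 1 &
      continuous (derive1n n g)].

(* The C^n norm is the largest sup-norm of the derivatives of order <= n. *)
Definition Cnorm (V : normedModType R) (nrm : V -> R) (n : nat) (g : R -> V)
    : \bar R :=
  ereal_sup [set (nrm (derive1n ks.1 g ks.2))%:E | ks in
              [set ks : nat * R | (ks.1 <= n)%N]].

Definition fnorm (n : nat) f : \bar R := Cnorm (fun x => `|x|) n f.

Definition xnorm (n : nat) X : \bar R := Cnorm enorm n X.

Definition dpart1 K : R -> R -> R := fun s t => derive1 (K ^~ t) s.

Definition dpart2 K : R -> R -> R := fun s t => derive1 (K s) t.

Fixpoint Ck2 (m : nat) K : Prop :=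
  continuous (fun z : R * R => K z.1 z.2) /\
  if m is m'.+1 then
    [/\ forall s t, derivable (K ^~ t) s 1 /\ derivable (K s) t 1,
        Ck2 m' (dpart1 K) & Ck2 m' (dpart2 K)]
  else True.

Definition CkT2 (m : nat) K : Prop :=
  [/\ forall t, periodic (K ^~ t), forall s, periodic (K s) & Ck2 m K].

(* For a kernel of class C^m the mixed partial derivatives commute, so one
   order of differentiation suffices. *)
Definition knorm (m : nat) K : \bar R :=
  ereal_sup [set `|iter z.1.1 dpart1 (iter z.1.2 dpart2 K) z.2.1 z.2.2|%:E
            | z in [set z : (nat * nat) * (R * R) | (z.1.1 + z.1.2 <= m)%N]].

Definition curves (n : nat) (M c0 c1 : R) : set (R -> R * R) :=
  [set X | [/\ CkT n X, (xnorm n X <= M%:E)%E,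
               forall s, c0 <= enorm (derive1 X s) &
               forall s t,
                 c1 * `|2 * sin ((s - t) / 2)| <= enorm (X s - X t)]].

End circle.

(* A periodic distribution is given by its complex Fourier coefficients
   (2 pi)^-1 <T, exp(- i k t)>, each stored as (real part, imaginary part).
   The symbols below are real, hence act by real scaling. *)
Section distributions.
Context {R : realType}.
Implicit Types (f g : R -> R) (T : int -> R * R).

Definition fourier g : int -> R * R := fun k =>
  ((2 * pi)^-1 * (\int[circ]_t (g t * cos (k%:~R * t)))%R,
   - ((2 * pi)^-1 * (\int[circ]_t (g t * sin (k%:~R * t)))%R)).

Definition multiplier (symb : int -> R) T : int -> R * R :=
  fun k => symb k *: T k.

Definition W0 : (int -> R * R) -> int -> R * R :=
  multiplier (fun k => `|k|%:~R / 2).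

Definition W0_trunc (K : nat) : (int -> R * R) -> int -> R * R :=
  multiplier (fun k => if (`|k| <= K%:Z)%R then `|k|%:~R / 2 else 0).

(* L^2 norm of a distribution; +oo when no L^2 function represents it. *)
Definition dist_L2norm T : \bar R :=
  ereal_inf [set L2norm g | g in [set g | L2T g /\ fourier g = T]].

End distributions.

Section dirichlet_to_neumann.
Context {R : realType}.
Implicit Types (f g : R -> R) (X : R -> R * R) (u : R * R -> R)
  (T : int -> R * R).

(* The points off the curve whose component in the complement of the curve is
   bounded; for a Jordan curve this is the bounded domain that it encloses. *)
Definition enclosed X : set (R * R) :=
  [set p | ~ range X p /\
           bounded_set (connected_component (~` range X) p)].

Definition dirx : R * R := (1, 0).
Definition diry : R * R := (0, 1).

Definition harmonic_on (Omega : set (R * R)) u : Prop :=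
  forall p, Omega p ->
    (forall v w, [/\ derivable u p v, derivable ('D_v u) p w &
                     {for p, continuous ('D_w ('D_v u))}]) /\
    'D_dirx ('D_dirx u) p + 'D_diry ('D_diry u) p = 0.

Definition outward_normal X (s : R) (nu : R * R) : Prop :=
  [/\ nu.1 * (derive1 X s).1 + nu.2 * (derive1 X s).2 = 0,
      enorm nu = 1 &
      \forall h \near 0^'+, enclosed X (X s - h *: nu) /\
        ~ closure (enclosed X) (X s + h *: nu)].

(* g = (d_n u o X) |X'| for a classical solution u of the Dirichlet problem,
   of class C^2 inside and C^1 up to the boundary; G is grad u. *)
Definition classical_dtn X f g : Prop :=
  exists (u : R * R -> R) (G : R * R -> R * R) (nu : R -> R * R),
    [/\ harmonic_on (enclosed X) u /\
          {within closure (enclosed X), continuous u},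
        forall s, u (X s) = f s,
        (forall p, enclosed X p -> G p = ('D_dirx u p, 'D_diry u p)) /\
          {within closure (enclosed X), continuous G},
        forall s, outward_normal X s (nu s) &
        forall s, g s = ((G (X s)).1 * (nu s).1 + (G (X s)).2 * (nu s).2)
                        * enorm (derive1 X s)].

(* Extension of the previous operator by continuity from L^2(T) to
   distributions, so that data without a classical solution are allowed. *)
Definition dtn_graph X f T : Prop :=
  exists (fs gs : nat -> R -> R),
    [/\ forall j, classical_dtn X (fs j) (gs j),
        (fun j => L2norm (fs j \- f)) @ \oo --> 0%E &
        forall k, (fun j => fourier (gs j) k) @ \oo --> T k].

Definition dtn X f : int -> R * R :=
  xget (fun=> 0) [set T | dtn_graph X f T].

(* The function representing the distribution dtn X f - 2 W0 f. *)
Definition represents_remainder X f g : Prop :=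
  L2T g /\ fourier g = dtn X f - 2 *: W0 (fourier f).

Definition remainder X f : R -> R :=
  xget (fun=> 0) [set g | represents_remainder X f g].

(* The data for which dtn X f and remainder X f are not default values. *)
Definition in_domain X f : Prop :=
  [/\ L2T f, exists T, dtn_graph X f T &
      exists g, represents_remainder X f g].

Record admissible_remainder (A : set (R -> R * R))
    (ker : (R -> R * R) -> R -> R -> R) (n m mu0 nu : nat) (MR LR : R)
    : Prop := {
  ar_m : (1 <= m)%N;
  ar_mu0 : (mu0 <= m)%N;
  ar_nu : (nu < n)%N;
  ar_MR : 0 <= MR;
  ar_LR : 0 <= LR;
  ar_kernel : forall X f, A X -> in_domain X f ->
    {ae circ, forall s, remainder X f s = (\int[circ]_t (ker X s t * f t))%R};
  ar_bound : forall X, A X ->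
    CkT2 m (ker X) /\ (knorm m (ker X) <= MR%:E)%E;
  ar_lip : forall X Y, A X -> A Y ->
    (knorm mu0 (fun s t => ker X s t - ker Y s t)%R
      <= LR%:E * xnorm nu (X \- Y)%R)%E
}.

End dirichlet_to_neumann.

Section deeponet.
Context {R : realType}.

Definition node (J : nat) (j : 'I_J) : R := 2 * pi * j%:R / J%:R.

Definition samples (J : nat) (X : R -> R * R) : 'I_J -> R * R :=
  fun j => X (node j).
Arguments samples : clear implicits.

Definition deeponet (r J : nat) (Theta : Type)
    (tau : Theta -> 'I_r -> R -> R)
    (rho : Theta -> 'I_r -> (R -> R) -> ('I_J -> R * R) -> R)
    (th : Theta) (f : R -> R) (X : R -> R * R) : R -> R :=
  fun s => \sum_(k < r) tau th k s * rho th k f (samples J X).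

End deeponet.
Arguments samples {R} J X j.

(* A probability distribution of pairs (f, X) is a Borel probability measure on
   a topological space D of pairs; p : D stands for (bdry p, geom p). *)
Notation borel D := (g_sigma_algebraType (@open D)).

Definition supp {R : realType} (D : ptopologicalType)
    (mu : probability (borel D) R) : set D :=
  [set p | forall U : set D, open U -> U p -> (0 < mu U)%E].

Section learning.
Context {R : realType} (D : ptopologicalType).
Variables (bdry : D -> R -> R) (geom : D -> R -> R * R).
Variable mu : probability (borel D) R.
Variables (Theta : Type) (N_ : Theta -> (R -> R) -> (R -> R * R) -> R -> R).
Local Open Scope ereal_scope.

Definition model_error (th : Theta) (p : D) : \bar R :=
  L2norm (fun s => N_ th (bdry p) (geom p) s
                   - remainder (geom p) (bdry p) s)%R.

Definition loss_pop (th : Theta) : \bar R :=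
  \int[mu]_(p in [set: borel D]) (model_error th p) ^+ 2.

Definition loss_emp (N : nat) (x : 'I_N -> D) (th : Theta) : \bar R :=
  (N%:R^-1)%:E * \sum_(i < N) (model_error th (x i)) ^+ 2.

Definition gen_gap (Th : set Theta) (N : nat) (x : 'I_N -> D) : \bar R :=
  ereal_sup [set `|loss_pop th - loss_emp x th| | th in Th].

Definition det_error (th : Theta) (E : \bar R) : Prop :=
  0 <= E /\ ereal_sup [set model_error th p | p in supp mu] <= E.

(* Root mean square over mu of the L^2 distance between dtn and
   2 W + N_ th, where W is a multiplier acting on Fourier coefficients. *)
Definition dtn_rms (W : (int -> R * R) -> int -> R * R) (th : Theta)
    : \bar R :=
  sqrte (\int[mu]_(p in [set: borel D])
    (dist_L2norm (dtn (geom p) (bdry p)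
       - (2 *: W (fourier (bdry p))
          + fourier (N_ th (bdry p) (geom p))))%R) ^+ 2).

Definition trunc_error (K : nat) (p : D) : \bar R :=
  dist_L2norm (2 *: W0 (fourier (bdry p))
               - 2 *: W0_trunc K (fourier (bdry p)))%R.

End learning.

Section finite_node.
Context {R : realType}.

Record node_data (r J : nat) := {
  nd_ker : (R -> R * R) -> R -> R -> R; (* R(s, t; X) = nd_ker X s t *)
  nd_m : nat; nd_mu0 : nat; nd_nu : nat;
  nd_MR : R; nd_LR : R;
  nd_Pi : forall L : nat, ('I_L -> R * R) -> R -> R * R; (* Pi_L *)
  nd_CPi : R; nd_J0 : nat;
  nd_q : nat; nd_w : 'I_J -> R; nd_CQ : R; nd_Cprod : R;
  nd_a : 'I_r -> R -> R;
  nd_b : 'I_r -> (R -> R * R) -> R -> R; (* b_k(t; X_J) = nd_b k X_J t *)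
  nd_Cker : R;
  nd_ahat : 'I_r -> R -> R;
  nd_bhat : 'I_r -> ('I_J -> R * R) -> R -> R; (* at Z_J(X) *)
  nd_da : 'I_r -> R; nd_db : 'I_r -> R;
  nd_B : R
}.

Variables (n : nat) (M c0 c1 : R) (D : ptopologicalType).
Variables (bdry : D -> R -> R) (geom : D -> R -> R * R).
Variable mu : probability (borel D) R.
Variables (r J : nat).
Implicit Type d : node_data r J.

(* X_J, the curve rebuilt from the node values of X. *)
Definition recon d (L : nat) (X : R -> R * R) : R -> R * R :=
  nd_Pi d (samples L X).

Record finite_node d (Nstar : (R -> R) -> (R -> R * R) -> R -> R) : Prop := {
  fn_class_large : admissible_remainder (curves n (2 * M) (c0 / 2) (c1 / 2))
    (nd_ker d) n (nd_m d) (nd_mu0 d) (nd_nu d) (nd_MR d) (nd_LR d);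
  fn_class : admissible_remainder (curves n M c0 c1)
    (nd_ker d) n (nd_m d) (nd_mu0 d) (nd_nu d) (nd_MR d) (nd_LR d);
  fn_recon : 0 <= nd_CPi d /\
    forall X L, curves n M c0 c1 X -> (0 < L)%N -> (nd_J0 d <= L)%N ->
      curves n (2 * M) (c0 / 2) (c1 / 2) (recon d L X) /\
      (xnorm (nd_nu d) (X \- recon d L X)%R
        <= (nd_CPi d * L%:R ^- (n - nd_nu d))%:E * xnorm n X)%E;
  fn_quad : 0 <= nd_CQ d /\
    forall g : R -> R, CkT (nd_q d) g ->
      (`| (\int[circ]_t g t)%R - \sum_(j < J) nd_w d j * g (node j) |%:E
        <= (nd_CQ d * J%:R ^- nd_q d)%:E * fnorm (nd_q d) g)%E;
  fn_prod : forall g h : R -> R, CkT (nd_q d) g -> CkT (nd_q d) h ->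
      (fnorm (nd_q d) (g \* h)%R
        <= (nd_Cprod d)%:E * fnorm (nd_q d) g * fnorm (nd_q d) h)%E;
  fn_rank : (nd_m d <= r)%N /\ (nd_J0 d <= J)%N;
  fn_trunk : forall k, periodic (nd_a d k) /\
    nd_a d k \in Lfun circ +oo%E;
  fn_branch : forall k p, supp mu p ->
    CkT (nd_q d) (nd_b d k (recon d J (geom p)));
  fn_lowrank : 0 <= nd_Cker d /\ forall p, supp mu p ->
    (Lnorm (circ \x circ)%E +oo (fun z : R * R =>
        (nd_ker d (recon d J (geom p)) z.1 z.2
         - \sum_(k < r) nd_a d k z.1 * nd_b d k (recon d J (geom p)) z.2)%:E)
      <= (nd_Cker d * r%:R ^- nd_m d)%:E)%E;
  fn_net : forall p, supp mu p -> forall s,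
    Nstar (bdry p) (geom p) s =
    \sum_(k < r) nd_ahat d k s * \sum_(j < J)
      nd_w d j * nd_bhat d k (samples J (geom p)) (node j) * bdry p (node j);
  fn_da : forall k s, `|nd_a d k s - nd_ahat d k s| <= nd_da d k;
  fn_db : forall p, supp mu p -> forall k t,
    `|nd_b d k (recon d J (geom p)) t
      - nd_bhat d k (samples J (geom p)) t| <= nd_db d k;
  fn_input : forall p, supp mu p ->
    CkT (nd_q d) (bdry p) /\ (fnorm (nd_q d) (bdry p) <= (nd_B d)%:E)%E
}.

Local Open Scope ereal_scope.

Definition E_geom d : \bar R :=
  (2 * pi * nd_LR d * nd_CPi d * M * J%:R ^- (n - nd_nu d))%:E.

Definition E_rank d : \bar R := (2 * pi * nd_Cker d * r%:R ^- nd_m d)%:E.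

Definition E_quad d : \bar R :=
  ereal_sup [set (nd_CQ d * nd_Cprod d * J%:R ^- nd_q d)%:E *
      \sum_(k < r) Linf_norm (nd_a d k)
                   * fnorm (nd_q d) (nd_b d k (recon d J (geom p)))
    | p in supp mu].

Definition E_net d : \bar R :=
  ereal_sup [set (\sum_(j < J) `|nd_w d j|)%:E *
      \sum_(k < r) (Linf_norm (nd_b d k (recon d J (geom p))) * (nd_da d k)%:E
                    + Linf_norm (nd_a d k) * (nd_db d k)%:E
                    + (nd_da d k * nd_db d k)%:E)
    | p in supp mu].

End finite_node.

(* Main.v *)
Require Import Defs.
From mathcomp Require Import all_boot all_order all_algebra.
From mathcomp Require Import all_classical all_reals all_analysis.
From mathcomp Require Import measurable_realfun ess_sup_inf.
From mathcomp Require Import ring.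

Set Implicit Arguments.
Unset Strict Implicit.
Unset Printing Implicit Defensive.

Import Order.TTheory GRing.Theory Num.Theory.
Import numFieldNormedType.Exports.

Local Open Scope classical_set_scope.
Local Open Scope ring_scope.

(** Generalization. Let [P] and [E] be the population and the empirical loss and
    let gap be their largest difference over the parameter set. For an
    approximate empirical minimizer [th] and any competitor [th'],
    [P th <= P th' + eta + 2 gap] ([erm_sqrte_bound]). The competitor satisfies
    [P th' <= Edet ^ 2] because its error is at most [Edet] on the support of
    [mu], and the support of a Borel probability on a second countable space has
    full measure ([supp_ae]). Square roots are subadditive, which gives the
    bound on the loss.

    Dirichlet-to-Neumann maps. The remainder is the L^2 function whose Fourier
    coefficients are those of [dtn - 2 W0], so [dtn - (2 W0 + N)] is represented
    by the function remainder minus network and its norm is at most the model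
    error ([dtn_rms_le]). If [W0] is truncated, the tail of the multiplier is
    added; it is estimated by the triangle inequality on the circle and then by
    Minkowski's inequality in L^2(mu) ([dtn_rms_trunc_le]).

    Deterministic error. For almost every [s] the remainder is the integral of
    the kernel against the data. Replacing successively the kernel of the curve
    by that of the rebuilt curve, this one by its separated approximation, the
    integral by the quadrature rule, and the exact trunk and branch values by
    those of the network, one meets the geometry, rank, quadrature and
    realization errors, each multiplied by the bound [B] on the data
    ([pointwise_split_le], [finite_node_pointwise]). Integrating the square over
    the circle contributes the factor [sqrt (2 pi)], hence
    [C B = sqrt (2 pi) * B]. *)

(** * Integrals of nonnegative extended real functions *)

Section nonneg_integral.
Local Open Scope ereal_scope.
Context d (T : measurableType d) (R : realType).
Variable mu : {measure set T -> \bar R}.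
Implicit Types (f g a b : T -> \bar R).

(** The integral of a nonnegative function is a supremum over the simple
    functions below it, so it is monotone even on nonmeasurable functions. The
    distance of a distribution to zero in L^2 is an infimum over representatives
    whose measurability in the sample point is unclear; this lemma is what
    lets it be compared with measurable errors. *)
Lemma ge0_integral_mono f g :
  (forall x, 0 <= f x) -> (forall x, f x <= g x) ->
  \int[mu]_x f x <= \int[mu]_x g x.
Proof.
move=> f0 fg.
have g0 x : 0 <= g x by exact: le_trans (fg x).
rewrite !ge0_integralE// !patch_setT.
apply: ereal_sup_le => _ [h hf <-]; exists h => // x.
exact: le_trans (fg x).
Qed.

(** Square roots and squares, rather than real powers, are the form in which
    the losses are stated. *)
Lemma Lnorm2E (f : T -> R) :
  'N[mu]_2%:E[EFin \o f] = sqrte (\int[mu]_x (f x ^+ 2)%:E).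
Proof.
rewrite unlock poweR12_sqrt; last first.
  by apply: integral_ge0 => x _; exact: poweR_ge0.
congr sqrte; apply: eq_integral => x _ /=.
by rewrite powR_mulrn// real_normK// num_real.
Qed.

Lemma fineX2 (x : \bar R) : x \is a fin_num -> ((fine x) ^+ 2)%:E = x ^+ 2.
Proof. by case: x. Qed.

(** Extended real values are needed since the error of a network may be
    infinite at some samples. If a right-hand term is infinite there is
    nothing to prove; otherwise both functions are finite almost everywhere and
    the inequality reduces to Minkowski for their real parts. *)
Lemma minkowski2_ge0 a b : measurable_fun [set: T] a -> measurable_fun [set: T] b ->
  (forall x, 0 <= a x) -> (forall x, 0 <= b x) ->
  sqrte (\int[mu]_x (a x + b x) ^+ 2) <=
  sqrte (\int[mu]_x a x ^+ 2) + sqrte (\int[mu]_x b x ^+ 2).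
Proof.
move=> ma mb a0 b0.
have m2 c : measurable_fun [set: T] c -> measurable_fun [set: T] (fun x => c x ^+ 2).
  by move=> mc; apply: emeasurable_funM.
have sq0 (x : \bar R) : 0 <= x -> 0 <= x ^+ 2 by exact: expe_ge0.
have [->|aoo] := eqVneq (\int[mu]_x a x ^+ 2) +oo.
  by rewrite addye ?leey// gt_eqF// (lt_le_trans _ (sqrte_ge0 _)).
have [->|boo] := eqVneq (\int[mu]_x b x ^+ 2) +oo.
  by rewrite addey ?leey// gt_eqF// (lt_le_trans _ (sqrte_ge0 _)).
have fin c : measurable_fun [set: T] c -> (forall x, 0 <= c x) ->
    \int[mu]_x c x ^+ 2 != +oo -> {ae mu, forall x, c x \is a fin_num}.
  move=> mc c0 coo.
  have ic : mu.-integrable setT (fun x => c x ^+ 2).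
    apply/integrableP; split; first exact: m2.
    under eq_integral do rewrite gee0_abs ?sq0//.
    by rewrite ltey.
  apply: filterS (integrable_ae measurableT ic) => x /(_ I) /=.
  by move: (c0 x); case: (c x) => //=; rewrite expe2.
have key c : measurable_fun [set: T] c -> {ae mu, forall x, c x \is a fin_num} ->
    \int[mu]_x c x ^+ 2 = \int[mu]_x ((fine (c x)) ^+ 2)%:E.
  move=> mc fc; apply: ae_eq_integral => //; first exact: m2.
    apply/measurable_EFinP; apply: measurable_funX.
    exact: measurableT_comp.
  by apply: filterS fc => x fx _; rewrite fineX2.
have fa := fin _ ma a0 aoo; have fb := fin _ mb b0 boo.
rewrite (key _ ma)// (key _ mb)// (key (a \+ b))//; last 2 first.
- exact: emeasurable_funD.
- by apply: filterS2 fa fb => x; rewrite fin_numD => -> ->.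
have mfine (c : T -> \bar R) : measurable_fun [set: T] c ->
    measurable_fun [set: T] (fine \o c).
  by move=> mc; exact: measurableT_comp.
have := @minkowski_EFin _ _ _ mu (fine \o a) (fine \o b) 2 (mfine _ ma) (mfine _ mb).
rewrite !Lnorm2E => /(_ _)/(le_trans _); apply; last by rewrite ler1n.
rewrite lee_sqrt; last by apply: integral_ge0 => x _; rewrite lee_fin sqr_ge0.
apply: ae_ge0_le_integral => //.
- by move=> x _; rewrite lee_fin sqr_ge0.
- by apply/measurable_EFinP/measurable_funX/mfine/emeasurable_funD.
- by move=> x _; rewrite lee_fin sqr_ge0.
- by apply/measurable_EFinP/measurable_funX/measurable_funD; exact: mfine.
- by apply: filterS2 fa fb => x fax fbx _; rewrite /= fineD.
Qed.

End nonneg_integral.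

Section support.
Context {R : realType} (D : ptopologicalType).
Variable mu : probability (borel D) R.

(** A point outside the support has a null open neighbourhood, hence a null
    neighbourhood in a countable basis. The complement of the support is thus
    covered by countably many null sets. *)
Lemma supp_ae : @second_countable D -> {ae mu, forall p, supp mu p}.
Proof.
move=> [B cB [oB nB]].
have /countable_injP[e einj] := cB.
pose null := [set U | B U /\ (mu U = 0)%E].
(* Grouping the null basic open sets by their index [e U] turns the union over
   a countable family into a union over [nat]; each group has at most one
   member. *)
suff : mu.-negligible (\bigcup_n \bigcup_(U in [set U | null U /\ e U = n]) U).
  apply: negligibleS => p /= /existsNP[U /not_implyP[oU /not_implyP[Up /negP]]].
  rewrite -leNgt => muU0.
  have [V [BV Vp] VU] := nB p U (open_nbhs_nbhs (conj oU Up)).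
  exists (e V) => //; exists V => //; split=> //; split=> //.
  apply/eqP; rewrite eq_le measure_ge0 andbT (le_trans _ muU0)//.
  by apply: le_measure; rewrite ?inE //; apply: sub_sigma_algebra => //; exact: oB.
apply: negligible_bigcup => n.
have [[U [[BU muU0] eU]]|nU] := pselect (exists U, null U /\ e U = n); last first.
  rewrite (_ : \bigcup_(_ in _) _ = set0); first exact: negligible_set0.
  by rewrite -subset0 => p [U hU _]; apply: nU; exists U.
exists U; split=> //; first by apply: sub_sigma_algebra; exact: oB.
move=> p [V [[BV _] eV] Vp]; rewrite (einj U V) ?inE//.
by rewrite eU eV.
Qed.

Lemma supp_nonempty : @second_countable D -> exists p, supp mu p.
Proof.
move=> scD; have [N [mN N0 sN]] := supp_ae scD.
apply: contrapT => nsupp; have : (mu setT <= mu N)%E.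
  by apply: le_measure; rewrite ?inE// => p _; apply: sN => sp; apply: nsupp; exists p.
by rewrite N0 probability_setT lee_fin ler10.
Qed.

End support.

(** * Empirical risk minimization *)

Section erm.
Local Open Scope ereal_scope.
Context {R : realType}.
Implicit Types x y z : \bar R.

Lemma sqrteD_le x y : 0 <= x -> 0 <= y -> sqrte (x + y) <= sqrte x + sqrte y.
Proof.
move: x y => [x||] [y||] //= x0 y0; rewrite ?leey//.
rewrite !lee_fin in x0 y0 *.
rewrite -(@ler_pXn2r _ 2)// ?nnegrE ?addr_ge0 ?sqrtr_ge0//.
rewrite sqr_sqrtr ?addr_ge0// sqrrD !sqr_sqrtr// addrAC lerDl.
by rewrite mulrn_wge0// mulr_ge0// sqrtr_ge0.
Qed.

(** Holds for infinite values too: as soon as [x] or [y] is [+oo], so is the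
    distance, the difference of two equal infinities being [-oo] by
    convention. *)
Lemma le_abse_subl x y z : 0 <= x -> 0 <= y -> `|x - y| <= z -> x <= y + z.
Proof.
move: x y z => [x||] [y||] [z||] //= x0 y0; rewrite ?leey//.
rewrite !lee_fin => /(le_trans (ler_norm _)).
by rewrite lerBlDl.
Qed.

Lemma abse_subC x y : `|x - y| = `|y - x|.
Proof. by move: x y => [x||] [y||] //=; rewrite distrC. Qed.

(** The empirical risk minimization argument for an abstract pair of losses:
    [P th <= E th + gap <= E th' + eta + gap <= P th' + eta + 2 gap].
    The first and last steps use the uniform gap, the middle one that [th]
    almost minimizes [E]; subadditivity of the square root then separates
    the three contributions. *)
Lemma erm_sqrte_bound (Theta : Type) (Th : set Theta) (P E : Theta -> \bar R)
    (eta e : R) (th th' : Theta) :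
  (forall t, 0 <= P t) -> (forall t, 0 <= E t) -> (0 <= eta)%R -> (0 <= e)%R ->
  Th th -> Th th' ->
  E th <= ereal_inf [set E t | t in Th] + eta%:E ->
  P th' <= (e ^+ 2)%:E ->
  sqrte (P th) <= e%:E
    + sqrte (2%:E * ereal_sup [set `|P t - E t| | t in Th])
    + (Num.sqrt eta)%:E.
Proof.
move=> P0 E0 eta0 e0 Tth Tth' Emin Pe.
set gap := ereal_sup _.
have gapP t : Th t -> `|P t - E t| <= gap.
  by move=> Tt; apply: ereal_sup_ubound; exists t.
have gap0 : 0 <= gap by apply: le_trans (gapP _ Tth); exact: abse_ge0.
have -> : e%:E = sqrte (e ^+ 2)%:E by rewrite /= sqrtr_sqr ger0_norm.
rewrite -[(Num.sqrt eta)%:E]/(sqrte eta%:E).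
have gg0 : 0 <= 2%:E * gap by rewrite mule_ge0// lee_fin.
have e20 : 0 <= (e ^+ 2)%:E by rewrite lee_fin sqr_ge0.
have : P th <= (e ^+ 2)%:E + (2%:E * gap) + eta%:E.
  apply: (le_trans (le_abse_subl (P0 _) (E0 _) (gapP _ Tth))).
  have inf_le : ereal_inf [set E t | t in Th] <= E th'.
    by apply: ereal_inf_lbound; exists th'.
  have E' : E th' <= P th' + gap.
    by apply: le_abse_subl => //; rewrite abse_subC gapP.
  apply: (@le_trans _ _ (((e ^+ 2)%:E + gap + eta%:E) + gap)).
    rewrite leeD2r// (le_trans Emin)// leeD2r// (le_trans inf_le)//.
    by rewrite (le_trans E')// leeD2r.
  rewrite (_ : 2%:E * gap = gap + gap); last first.
    by rewrite -[2%R]/(1 + 1)%R EFinD ge0_muleDl ?lee_fin// mul1e.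
  by rewrite -!addeA [eta%:E + gap]addeC.
have eta0' : 0 <= eta%:E by rewrite lee_fin.
rewrite -(@lee_sqrt _ (P th)); last by rewrite !adde_ge0.
move/le_trans; apply.
apply: (le_trans (sqrteD_le _ _)); rewrite ?adde_ge0//.
rewrite leeD2r//; exact: sqrteD_le.
Qed.

End erm.

Section population_loss.
Local Open Scope ereal_scope.
Context {R : realType} (D : ptopologicalType).
Variables (bdry : D -> R -> R) (geom : D -> R -> R * R).
Variable mu : probability (borel D) R.
Variables (Theta : Type) (N_ : Theta -> (R -> R) -> (R -> R * R) -> R -> R).
Local Notation err := (model_error bdry geom N_).

Lemma model_error_ge0 th p : 0 <= err th p.
Proof. exact: Lnorm_ge0. Qed.

Lemma loss_pop_ge0 th : 0 <= loss_pop bdry geom mu N_ th.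
Proof. by apply: integral_ge0 => p _; rewrite expe_ge0// model_error_ge0. Qed.

Lemma loss_emp_ge0 (N : nat) (x : 'I_N -> D) th : 0 <= loss_emp bdry geom N_ x th.
Proof.
rewrite mule_ge0 ?lee_fin ?invr_ge0//.
by apply: sume_ge0 => i _; rewrite expe_ge0// model_error_ge0.
Qed.

(** The bound [e] on the error is known at points of the support; these carry
    all the mass. *)
Lemma loss_pop_det_error th (e : R) : @second_countable D ->
  measurable_fun [set: borel D] (err th) ->
  det_error bdry geom mu N_ th e%:E ->
  loss_pop bdry geom mu N_ th <= (e ^+ 2)%:E.
Proof.
move=> scD merr [e0 supe].
have -> : (e ^+ 2)%:E = \int[mu]_p (cst (e ^+ 2)%:E p).
  rewrite integral_cst// -[LHS]mule1; congr (_ * _); exact/esym/probability_setT.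
apply: ae_ge0_le_integral => //.
- by move=> p _; rewrite expe_ge0// model_error_ge0.
- exact: emeasurable_funM.
- by move=> p _; rewrite lee_fin sqr_ge0.
have [N [mN N0 sN]] := supp_ae mu scD.
exists N; split=> // p np; apply: sN => sp; apply: np => _.
have : err th p <= e%:E by apply: le_trans supe; apply: ereal_sup_ubound; exists p.
by rewrite expe2 EFin_expe expe2 => ?; rewrite lee_pmul ?model_error_ge0.
Qed.

End population_loss.

(** * Fourier coefficients and the norm of a distribution *)

Section L2_circle.
Context {R : realType}.
Implicit Types (f g : R -> R).

Lemma L2T_measurable g : L2T g -> measurable_fun [set: measurableTypeR R] g.
Proof. by move=> [_ /andP[/[!inE]]]. Qed.

Lemma L2T_add f g : L2T f -> L2T g -> L2T (f \+ g).
Proof.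
move=> [pf lf] [pg lg]; split; first by move=> s /=; rewrite pf pg.
exact: (Lfun_addr_closed circ (lee1n 2)).2.
Qed.

Lemma L2T_sub f g : L2T f -> L2T g -> L2T (f \- g).
Proof.
move=> Lf [pg lg]; apply: (@L2T_add f (\- g)) => //.
split; first by move=> s /=; rewrite pg.
exact: (Lfun_oppr_closed lg).
Qed.

Lemma L2T0 : L2T (cst 0 : R -> R).
Proof. by split=> //; exact: (Lfun_addr_closed circ (lee1n 2)).1. Qed.

Lemma L2T_lincomb (r : nat) (tau : 'I_r -> R -> R) (c : 'I_r -> R) :
  (forall k, L2T (tau k)) -> L2T (fun s => \sum_(k < r) tau k s * c k).
Proof.
move=> Ltau; rewrite -(fct_sumE _ _ (fun k s => tau k s * c k)).
elim/big_ind: _ => [|f g|k _]; [exact: L2T0|exact: L2T_add|].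
have [pk lk] := Ltau k; split; first by move=> s; rewrite pk.
by apply: Lfun_scale => //; rewrite ler1n.
Qed.

Lemma L2norm_subC f g : L2norm (f \- g) = L2norm (g \- f).
Proof.
rewrite /L2norm !Lnorm2E; congr sqrte; apply: eq_integral => x _ /=.
by rewrite -sqrrN opprB.
Qed.

Lemma L2T_integrable g : L2T g -> circ.-integrable setT (EFin \o g).
Proof.
move=> [_ lg]; apply/Lfun1_integrable; apply: Lfun_subset12 lg.
exact: circ_fin.
Qed.

Lemma L2T_mul_integrable g (h : R -> R) : L2T g -> measurable_fun [set: measurableTypeR R] h ->
  (forall t, `|h t| <= 1) -> circ.-integrable setT (EFin \o (g \* h)).
Proof.
move=> Lg mh h1; apply: le_integrable (L2T_integrable Lg) => //.
  by apply/measurable_EFinP/measurable_funM => //; exact: L2T_measurable.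
by move=> x _; rewrite /= lee_fin normrM ler_piMr.
Qed.

Lemma fourier_add f g : L2T f -> L2T g ->
  fourier (f \+ g) = fourier f + fourier g.
Proof.
move=> Lf Lg; apply/funext => k.
have mk : measurable_fun [set: measurableTypeR R] (fun t : R => k%:~R * t).
  exact: measurable_funM.
have mcos : measurable_fun [set: measurableTypeR R] (fun t : R => cos (k%:~R * t)).
  apply: measurableT_comp mk; apply: continuous_measurable_fun.
  exact: continuous_cos.
have msin : measurable_fun [set: measurableTypeR R] (fun t : R => sin (k%:~R * t)).
  apply: measurableT_comp mk; apply: continuous_measurable_fun.
  exact: continuous_sin.
have c1 t : `|cos (k%:~R * t : R)| <= 1 by rewrite ler_norml cos_geN1 cos_le1.
have s1 t : `|sin (k%:~R * t : R)| <= 1 by rewrite ler_norml sin_geN1 sin_le1.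
rewrite /fourier /=; congr pair.
  rewrite -mulrDr -RintegralD//; [|exact: L2T_mul_integrable..].
  by congr (_ * _); apply: eq_Rintegral => t _; rewrite mulrDl.
rewrite -opprD -mulrDr -RintegralD//; [|exact: L2T_mul_integrable..].
by congr (- (_ * _)); apply: eq_Rintegral => t _; rewrite mulrDl.
Qed.

Lemma fourier_sub f g : L2T f -> L2T g ->
  fourier (f \- g) = fourier f - fourier g.
Proof.
move=> Lf Lg; apply: (addIr (fourier g)); rewrite subrK -fourier_add//; last exact: L2T_sub.
by congr fourier; apply/funext => t /=; rewrite subrK.
Qed.

Implicit Types T : int -> R * R.

Lemma L2norm_ge0 g : (0 <= L2norm g)%E.
Proof. exact: Lnorm_ge0. Qed.

Lemma dist_L2norm_ge0 T : (0 <= dist_L2norm T)%E.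
Proof. by apply: le_ereal_inf_tmp => _ [g _ <-]; exact: L2norm_ge0. Qed.

Lemma dist_L2norm_fourier g : L2T g -> (dist_L2norm (fourier g) <= L2norm g)%E.
Proof. by move=> Lg; apply: ereal_inf_lbound; exists g. Qed.

(** Triangle inequality: adding [g] to any representative of [T] gives a
    representative of [fourier g + T]. *)
Lemma dist_L2norm_fourierD g T : L2T g ->
  (dist_L2norm (fourier g + T)%R <= L2norm g + dist_L2norm T)%E.
Proof.
move=> Lg.
have gfin : L2norm g \is a fin_num.
  by case: Lg => _ /andP[_ /[!inE]] ?; rewrite ge0_fin_numE ?L2norm_ge0.
rewrite -leeBlDl//; apply: le_ereal_inf_tmp => _ [h [Lh <-] <-].
rewrite leeBlDl// -fourier_add//.
apply: le_trans (dist_L2norm_fourier (L2T_add Lg Lh)) _.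
apply: minkowski_EFin; [exact: L2T_measurable..|by rewrite ler1n].
Qed.

End L2_circle.

Section dtn_error.
Context {R : realType}.

Lemma fourier_remainder (X : R -> R * R) (f : R -> R) : in_domain X f ->
  L2T (remainder X f) /\
  fourier (remainder X f) = dtn X f - 2 *: W0 (fourier f).
Proof. by move=> [_ _ rX]; exact: (xgetPex (fun=> 0) rX). Qed.

(** The multiplier part cancels: what is left is the function by which the
    network misses the remainder, plus the discrepancy between [2 W0] and the
    part [S] used instead. *)
Lemma dtn_errorE (X : R -> R * R) (f g : R -> R) (S : int -> R * R) :
  in_domain X f -> L2T g ->
  dtn X f - (S + fourier g) =
  fourier (remainder X f \- g) + (2 *: W0 (fourier f) - S).
Proof.
move=> dXf Lg; have [Lr rE] := fourier_remainder dXf.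
rewrite fourier_sub// rE opprD addrA [RHS]addrAC.
by congr (_ - _); rewrite addrA subrK.
Qed.

End dtn_error.

Section dtn_rms_bounds.
Local Open Scope ereal_scope.
Context {R : realType} (D : ptopologicalType).
Variables (bdry : D -> R -> R) (geom : D -> R -> R * R).
Variable mu : probability (borel D) R.
Variables (Theta : Type) (N_ : Theta -> (R -> R) -> (R -> R * R) -> R -> R).
Variable th : Theta.
Hypothesis dom : forall p, in_domain (geom p) (bdry p).
Hypothesis LN : forall p, L2T (N_ th (bdry p) (geom p)).

Lemma dtn_rms_le : dtn_rms bdry geom mu N_ W0 th <=
  sqrte (loss_pop bdry geom mu N_ th).
Proof.
rewrite lee_sqrt ?loss_pop_ge0//.
apply: ge0_integral_mono => p; first by rewrite expe_ge0// dist_L2norm_ge0.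
have le_err : dist_L2norm (dtn (geom p) (bdry p)
    - (2 *: W0 (fourier (bdry p)) + fourier (N_ th (bdry p) (geom p))))%R <=
    model_error bdry geom N_ th p.
  rewrite dtn_errorE// subrr addr0 /model_error L2norm_subC.
  apply: dist_L2norm_fourier; apply: L2T_sub => //.
  by have [] := fourier_remainder (dom p).
by rewrite !expe2 lee_pmul ?dist_L2norm_ge0.
Qed.

Lemma dtn_rms_trunc_le (K : nat) :
  measurable_fun [set: borel D] (model_error bdry geom N_ th) ->
  measurable_fun [set: borel D] (trunc_error bdry K) ->
  dtn_rms bdry geom mu N_ (W0_trunc K) th <=
  sqrte (loss_pop bdry geom mu N_ th)
  + sqrte (\int[mu]_(p in [set: borel D]) (trunc_error bdry K p) ^+ 2).
Proof.
move=> merr mtrunc.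
apply: le_trans (minkowski2_ge0 mu merr mtrunc _ _); last 2 first.
- by move=> p; exact: model_error_ge0.
- by move=> p; exact: dist_L2norm_ge0.
rewrite lee_sqrt; last first.
  by apply: integral_ge0 => p _; rewrite expe_ge0// adde_ge0 ?model_error_ge0 ?dist_L2norm_ge0.
apply: ge0_integral_mono => p; first by rewrite expe_ge0// dist_L2norm_ge0.
have le_err : dist_L2norm (dtn (geom p) (bdry p)
    - (2 *: W0_trunc K (fourier (bdry p)) + fourier (N_ th (bdry p) (geom p))))%R <=
    model_error bdry geom N_ th p + trunc_error bdry K p.
  rewrite dtn_errorE// /model_error L2norm_subC.
  apply: dist_L2norm_fourierD; apply: L2T_sub => //.
  by have [] := fourier_remainder (dom p).
by rewrite !expe2 lee_pmul ?dist_L2norm_ge0.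
Qed.

End dtn_rms_bounds.

(** * Sup norms and integrals over the circle *)

Section circle_estimates.
Context {R : realType}.
Implicit Types (f g h a : R -> R).
Local Notation circ := (@circ R).

Lemma twopi_gt0 : 0 < 2 * pi :> R.
Proof. by rewrite mulr_gt0// pi_gt0. Qed.

Lemma circT : circ setT = (2 * pi)%:E.
Proof.
rewrite /Defs.circ /mrestr setTI lebesgue_measure_itv /= lte_fin twopi_gt0.
by rewrite -EFinB subr0.
Qed.

Lemma circT_gt0 : (0 < circ setT)%E.
Proof. by rewrite circT lte_fin twopi_gt0. Qed.

Lemma circ_outside : circ (~` `[0, 2 * pi]) = 0%E.
Proof. by rewrite /Defs.circ /mrestr setICl measure0. Qed.

(** Continuity on the line does not bound [g], but only the compact interval
    [[0, 2 pi]] is charged by the measure. *)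
Lemma continuous_circ_integrable g :
  continuous g -> circ.-integrable setT (EFin \o g).
Proof.
move=> cg.
have mg : measurable_fun [set: measurableTypeR R] g.
  exact: continuous_measurable_fun.
pose A : set (measurableTypeR R) := `[0, 2 * pi]%classic.
have mA : measurable A by exact: measurable_itv.
apply/(negligible_integrable (measurableC mA)) => //.
- exact/measurable_EFinP.
- exact: circ_outside.
rewrite setTD setCK; apply: measurable_bounded_integrable => //.
- by rewrite ltey_eq circ_fin.
- exact: measurable_funS mg.
- have cA : {within `[0, 2 * pi], continuous g} by exact: continuous_subspaceT.
  have /compact_bounded[M [_ gM]] := continuous_compact cA (@segment_compact _ _ _).
  by exists M; split; rewrite ?num_real // => y My x Ax; apply: gM => //; exists x.
Qed.

Lemma normr_Rintegral_circ_le h (c : R) :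
  circ.-integrable setT (EFin \o h) -> {ae circ, forall t, `|h t| <= c} ->
  `|\int[circ]_t h t| <= 2 * pi * c.
Proof.
move=> ih hc.
rewrite -lee_fin EFin_normr_Rintegral//.
have mh : measurable_fun setT (EFin \o h) by have /integrableP[] := ih.
have c0 : 0 <= c.
  rewrite leNgt; apply/negP => c0; have [N [mN N0 hN]] := hc.
  suff : circ setT = 0%E by rewrite circT => -[] /eqP; rewrite gt_eqF// twopi_gt0.
  apply/eqP; rewrite eq_le measure_ge0 andbT -N0 le_measure ?inE//.
  by move=> x _; apply: hN; rewrite /= leNgt (lt_le_trans c0).
apply: (le_trans (le_abse_integral _ _ _)) => //.
rewrite mulrC EFinM -circT -integral_cst//.
apply: ae_ge0_le_integral => //; first exact: measurableT_comp.
case: hc => N [mN N0 hN]; exists N; split=> // x nx; apply: hN => hx; apply: nx => _.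
by rewrite lee_fin.
Qed.

Lemma Linf_norm_ae a : {ae circ, forall s, (`|a s|%:E <= Linf_norm a)%E}.
Proof.
rewrite /Linf_norm unlock /=; case: ifPn => [_|/negP[]]; first exact: ess_sup_ge.
exact: circT_gt0.
Qed.

Lemma Linf_norm_ge0 a : (0 <= Linf_norm a)%E.
Proof. exact: Lnorm_ge0. Qed.

(** Turns an essential supremum into a pointwise bound, as needed at the
    quadrature nodes: if [|g s|] exceeded the essential supremum, so would
    [|g|] on some interval [[s, s + l]] inside [[0, 2 pi]], which has positive
    measure. The strict bound [s < 2 pi] leaves room on the right. *)
Lemma continuous_le_Linf_norm g (s : R) : continuous g -> 0 <= s < 2 * pi ->
  (`|g s|%:E <= Linf_norm g)%E.
Proof.
move=> cg /andP[s0 s2].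
have := Linf_norm_ge0 g; have := Linf_norm_ae g.
case: (Linf_norm g) => [c|_ _|//]; last by rewrite leey.
move=> [N [mN N0 gN]] c0; rewrite lee_fin leNgt; apply/negP => cgs.
have : \forall x \near s, c < `|g x|.
  have : `|g x| @[x --> s] --> `|g s| by apply: cvg_norm; exact: cg.
  by move/cvgr_gt; apply.
move=> [e /= e0 eg].
pose l := Num.min (e / 2) (2 * pi - s).
have l0 : 0 < l by rewrite lt_min divr_gt0//= subr_gt0.
have : (0 < circ N)%E.
  apply: (@lt_le_trans _ _ (circ `[s, s + l]%classic)).
    rewrite /Defs.circ /mrestr setIidl; last first.
      move=> x /=; rewrite !in_itv /= => /andP[sx xl].
      rewrite (le_trans s0)//= (le_trans xl)//.
      by rewrite -lerBrDl ge_min lexx orbT.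
    by rewrite lebesgue_measure_itv /= lte_fin ltrDl l0 -EFinB lte_fin addrC addKr.
  apply: le_measure; rewrite ?inE//.
  move=> x /=; rewrite in_itv /= => /andP[sx xl]; apply: gN => /=.
  rewrite lee_fin leNgt; apply/negP; rewrite negbK; apply: eg => /=.
  rewrite distrC ger0_norm ?subr_ge0// ltrBlDl (le_lt_trans xl)// ltrD2l.
  by rewrite (@le_lt_trans _ _ (e / 2)) ?ge_min ?lexx// ltr_pdivrMr// ltr_pMr// ltr1n.
by rewrite N0 ltxx.
Qed.

(** The bound [c] may be infinite, as the quadrature and network error terms
    are suprema over the support. *)
Lemma L2norm_le_sup g (c : \bar R) : measurable_fun [set: measurableTypeR R] g ->
  {ae circ, forall s, (`|g s|%:E <= c)%E} ->
  (L2norm g <= (Num.sqrt (2 * pi))%:E * c)%E.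
Proof.
move=> mg gc.
have sqrt2pi : 0 < Num.sqrt (2 * pi) :> R by rewrite sqrtr_gt0 twopi_gt0.
case: c gc => [c||] gc; last 2 first.
- by rewrite gt0_muley ?leey// lte_fin.
- have [N [mN N0 gN]] := gc.
  have : circ setT = 0%E.
    apply/eqP; rewrite eq_le measure_ge0 andbT -N0 le_measure ?inE//.
    by move=> x _; apply: gN; rewrite /= leNgt ltNyr.
  by rewrite circT => -[] /eqP; rewrite gt_eqF// twopi_gt0.
have c0 : 0 <= c.
  rewrite leNgt; apply/negP => c0; have [N [mN N0 gN]] := gc.
  have : circ setT = 0%E.
    apply/eqP; rewrite eq_le measure_ge0 andbT -N0 le_measure ?inE//.
    by move=> x _; apply: gN; rewrite /= lee_fin leNgt (lt_le_trans c0).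
  by rewrite circT => -[] /eqP; rewrite gt_eqF// twopi_gt0.
rewrite /L2norm Lnorm2E -[c]ger0_norm// -sqrtr_sqr -EFinM -sqrtrM ?(ltW twopi_gt0)//.
rewrite -[leRHS]/(sqrte (2 * pi * c ^+ 2)%:E) lee_sqrt; last first.
  by rewrite lee_fin mulr_ge0 ?sqr_ge0// ltW// twopi_gt0.
rewrite mulrC EFinM -circT -integral_cst//.
apply: ae_ge0_le_integral => //.
- by move=> x _; rewrite lee_fin sqr_ge0.
- exact/measurable_EFinP/measurable_funX.
- by move=> x _; rewrite lee_fin sqr_ge0.
case: gc => N [mN N0 gN]; exists N; split=> // x nx; apply: gN => gx; apply: nx => _.
by rewrite lee_fin -real_normK ?num_real// ler_pXn2r// nnegrE.
Qed.

(** Tonelli for null sets: a null set of the product measure has null sections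
    at almost every abscissa. This converts the essential bound on the kernel
    of two variables into a bound on its slices. *)
Lemma product_circ_ae (P : R * R -> Prop) :
  {ae (circ \x circ)%E, forall z, P z} ->
  {ae circ, forall s, {ae circ, forall t, P (s, t)}}.
Proof.
move=> [N [mN N0 PN]].
have mx := measurable_fun_xsection circ mN.
have : (\int[circ]_s `|(circ \o xsection N) s| = 0)%E.
  by rewrite -[RHS]N0; apply: eq_integral => s _; rewrite gee0_abs.
move/(ae_eq_integral_abs _ measurableT mx) => [E [mE E0 sE]].
exists E; split=> // s ns; apply: sE => /(_ I) /= s0; apply: ns.
exists (xsection N s); split=> //; first exact: measurable_xsection.
by move=> t nt; rewrite /xsection /= inE; apply: PN.
Qed.

End circle_estimates.

(** * Functions of class C^n *)

Section Ck_functions.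
Context {R : realType}.
Implicit Types (f g h : R -> R).

(** The regularity part of [CkT]. Periodicity is split off so that [CkS]
    below is an equivalence, on which proofs by induction on [n] rest. *)
Definition Ck (n : nat) g : Prop :=
  (forall k, (k < n)%N -> forall s, derivable (derive1n k g) s 1) /\
  continuous (derive1n n g).

Lemma derivable_continuous g : (forall s : R, derivable g s 1) -> continuous g.
Proof.
by move=> dg s; apply: differentiable_continuous; apply/derivable1_diffP.
Qed.

Lemma CkS n g : Ck n.+1 g <-> (forall s, derivable g s 1) /\ Ck n (derive1 g).
Proof.
rewrite /Ck; split=> [[dg cg]|[dg [dg' cg]]].
  split; first by move=> s; exact: (dg 0%N).
  split; last by rewrite -derive1Sn.
  by move=> k kn s; rewrite -derive1Sn; exact: dg.
split; last by rewrite derive1Sn.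
by move=> [_|k kn] s; [exact: dg|rewrite derive1Sn; exact: dg'].
Qed.

Lemma Ck_pred n g : Ck n.+1 g -> Ck n g.
Proof.
move=> [dg _]; split; first by move=> k kn; apply: dg; rewrite ltnS ltnW.
by apply: derivable_continuous => s; exact: dg.
Qed.

Lemma Ck_continuous n g : Ck n g -> continuous g.
Proof. by elim: n => [[]//|n IHn] /Ck_pred. Qed.

Lemma Ck_add n f g : Ck n f -> Ck n g -> Ck n (f \+ g).
Proof.
elim: n f g => [|n IHn] f g.
  move=> [_ cf] [_ cg]; split=> // s.
  by apply: (@continuousD R R^o); [exact: cf|exact: cg].
move=> /CkS[df Cf] /CkS[dg Cg]; apply/CkS; split.
  by move=> s; exact: derivableD.
rewrite (_ : derive1 _ = derive1 f \+ derive1 g); first exact: IHn.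
by apply/funext => s; rewrite /= !derive1E deriveD.
Qed.

(** Induction through the Leibniz rule [(f g)' = f g' + g f'], in which [f] and
    [g] are used one order below their own. *)
Lemma Ck_mul n f g : Ck n f -> Ck n g -> Ck n (f \* g).
Proof.
elim: n f g => [|n IHn] f g.
  move=> [_ cf] [_ cg]; split=> // s.
  by apply: continuousM; [exact: cf|exact: cg].
move=> Cf Cg; have /CkS[df Cf'] := Cf; have /CkS[dg Cg'] := Cg.
apply/CkS; split; first by move=> s; exact: derivableM.
rewrite (_ : derive1 _ = (f \* derive1 g) \+ (g \* derive1 f)).
  by apply: Ck_add; apply: IHn => //; exact: Ck_pred.
by apply/funext => s; rewrite /= !derive1E deriveM.
Qed.

Lemma Ck_cst n (c : R) : Ck n (cst c).
Proof.
elim: n c => [c|n IHn c]; first by split=> // s; exact: cvg_cst.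
apply/CkS; split; first by move=> s; exact: derivable_cst.
rewrite (_ : derive1 _ = cst 0); first exact: IHn.
by apply/funext => s; rewrite derive1_cst.
Qed.

Lemma CkTE n g : CkT n g <-> Defs.periodic g /\ Ck n g.
Proof. by split=> [[]|[pg []]]. Qed.

Lemma CkT_mul n f g : CkT n f -> CkT n g -> CkT n (f \* g).
Proof.
move=> /CkTE[pf Cf] /CkTE[pg Cg]; apply/CkTE; split; last exact: Ck_mul.
by move=> s /=; rewrite pf pg.
Qed.

Lemma CkT_continuous n g : CkT n g -> continuous g.
Proof. by move=> /CkTE[_ /Ck_continuous]. Qed.

Lemma fnorm_ge n g s : (`|g s|%:E <= fnorm n g)%E.
Proof. by apply: ereal_sup_ubound; exists (0%N, s). Qed.

Lemma fnorm_ge0 n g : (0 <= fnorm n g)%E.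
Proof. by apply: le_trans (fnorm_ge n g 0); rewrite lee_fin. Qed.

Lemma knorm_ge m (K : R -> R -> R) s t : (`|K s t|%:E <= knorm m K)%E.
Proof. by apply: ereal_sup_ubound; exists ((0%N, 0%N), (s, t)). Qed.

Lemma Ck2_continuous_slice m (K : R -> R -> R) s : Ck2 m K -> continuous (K s).
Proof.
move=> CK; have cK : continuous (fun z : R * R => K z.1 z.2) by case: m CK => [|m] [].
move=> t; apply: (@continuous_comp _ _ _ (fun t : R => (s, t))
  (fun z : R * R => K z.1 z.2) t); last exact: cK.
have cs : (fun=> s) t' @[t' --> t] --> s by exact: cvg_cst.
exact: (cvg_pair cs (@cvg_id _ (nbhs t))).
Qed.

(** Test the product inequality on constant functions: the left-hand side is
    at least 1, whereas the right-hand side has the sign of [C]. *)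
Lemma product_constant_ge0 n (C : R) :
  (forall g h, CkT n g -> CkT n h ->
     (fnorm n (g \* h)%R <= C%:E * fnorm n g * fnorm n h)%E) -> 0 <= C.
Proof.
move=> Cprod; have C1 : CkT n (cst (1 : R)) by apply/CkTE; split=> //; exact: Ck_cst.
rewrite leNgt; apply/negP => C0.
have := le_trans (fnorm_ge n (cst 1 \* cst 1) 0) (Cprod _ _ C1 C1).
apply/negP; rewrite -ltNge /= mul1r normr1.
apply: (@le_lt_trans _ _ 0%E); last by rewrite lte_fin.
rewrite -muleA mule_le0_ge0 ?mule_ge0 ?fnorm_ge0// lee_fin ltW//.
Qed.

End Ck_functions.

(** * The realization error of a finite-node network *)

Section pointwise_split.
Context {R : realType}.
Local Notation circ := (@circ R).

Lemma continuous_lincomb (I : Type) (l : seq I) (c : I -> R) (h : I -> R -> R) :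
  (forall k, continuous (h k)) ->
  continuous (fun t => \sum_(k <- l) c k * h k t).
Proof.
move=> ch; elim: l => [|k l IHl].
  rewrite (_ : (fun t => _) = cst 0); first by move=> t; exact: cvg_cst.
  by apply/funext => t; rewrite big_nil.
rewrite (_ : (fun t => _) =
    (fun t => c k * h k t) \+ (fun t => \sum_(k <- l) c k * h k t)); last first.
  by apply/funext => t; rewrite big_cons.
move=> t; apply: (@cvgD R R^o); last exact: IHl.
by apply: cvgM; [exact: cvg_cst|exact: ch].
Qed.

Lemma Rintegral_circ_lincomb (I : Type) (l : seq I) (c : I -> R) (h : I -> R -> R) :
  (forall k, continuous (h k)) ->
  (\int[circ]_t \sum_(k <- l) c k * h k t)%R =
  \sum_(k <- l) c k * (\int[circ]_t h k t)%R.
Proof.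
move=> ch; elim: l => [|k l IHl].
  under eq_Rintegral do rewrite big_nil.
  by rewrite big_nil Rintegral_cst// mul0r.
under eq_Rintegral do rewrite big_cons.
rewrite big_cons -IHl -RintegralZl//; last exact: continuous_circ_integrable.
rewrite RintegralD//; apply: continuous_circ_integrable.
- by move=> t; apply: cvgM; [exact: cvg_cst|exact: ch].
- exact: continuous_lincomb.
Qed.

(** From [a b - ah bh = b (a - ah) + a (b - bh) - (a - ah) (b - bh)]: the
    approximations enter only through their distances to the exact factors. *)
Lemma realization_term_le (a ah b bh da db : R) :
  `|a - ah| <= da -> `|b - bh| <= db ->
  `|a * b - ah * bh| <= `|b| * da + `|a| * db + da * db.
Proof.
move=> ha hb.
have -> : a * b - ah * bh = b * (a - ah) + a * (b - bh) - (a - ah) * (b - bh) by ring.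
apply: le_trans (ler_normB _ _) _; apply: lerD.
  apply: le_trans (ler_normD _ _) _; rewrite !normrM.
  by apply: lerD; rewrite ler_wpM2l.
by rewrite normrM ler_pM.
Qed.

Variables (r J : nat) (f u v : R -> R).
Variables (a ah da db : 'I_r -> R) (b : 'I_r -> R -> R) (bh : 'I_r -> 'I_J -> R).
Variables (w x : 'I_J -> R) (B g e : R).
Hypotheses (cf : continuous f) (cu : continuous u) (cv : continuous v)
  (cb : forall k, continuous (b k)).
Hypothesis fB : forall t, `|f t| <= B.
Hypothesis uvg : forall t, `|u t - v t| <= g.
Hypothesis ve : {ae circ, forall t, `|v t - \sum_(k < r) a k * b k t| <= e}.
Hypothesis aa : forall k, `|a k - ah k| <= da k.
Hypothesis bb : forall k j, `|b k (x j) - bh k j| <= db k.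

Let quad_err k :=
  (\int[circ]_t (b k t * f t))%R - \sum_(j < J) w j * (b k (x j) * f (x j)).

Let continuous_mulf (h : R -> R) : continuous h -> continuous (fun t => h t * f t).
Proof. by move=> ch t; apply: cvgM; [exact: ch|exact: cf]. Qed.

(** The error at one point [s] of the circle, where [u] and [v] stand for the
    slices at [s] of the true kernel and of the kernel of the rebuilt curve,
    and [a k], [ah k] for the exact and realized trunk values. Writing [ab] for
    the separated kernel, the difference splits telescopically as
    [int (u - v) f], geometry; [int (v - ab) f], rank; the quadrature errors of
    [b k * f], weighted by [a k]; and the difference of the two discrete sums,
    realization. The rank hypothesis is almost everywhere in [t] since the
    kernel approximation is measured in the essential supremum norm. *)
Lemma pointwise_split_le :
  `|\sum_(k < r) ah k * (\sum_(j < J) w j * bh k j * f (x j))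
      - (\int[circ]_t (u t * f t))%R| <=
  B * (2 * pi * e + 2 * pi * g) + \sum_(k < r) `|a k| * `|quad_err k|
  + B * \sum_(j < J) `|w j|
      * \sum_(k < r) (`|b k (x j)| * da k + `|a k| * db k + da k * db k).
Proof.
have B0 : 0 <= B by apply: le_trans (fB 0).
pose ab t := \sum_(k < r) a k * b k t.
have cab : continuous ab by exact: continuous_lincomb.
have csub (h1 h2 : R -> R) : continuous h1 -> continuous h2 ->
    continuous (fun t => (h1 t - h2 t) * f t).
  move=> c1 c2; apply: continuous_mulf => t.
  by apply: cvgB; [exact: c1|exact: c2].
have intabE : (\int[circ]_t (ab t * f t))%R =
    \sum_(k < r) a k * (\int[circ]_t (b k t * f t))%R.
  rewrite -Rintegral_circ_lincomb; last by move=> k; exact: continuous_mulf.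
  apply: eq_Rintegral => t _; rewrite /ab mulr_suml.
  by apply: eq_bigr => k _; rewrite mulrA.
have intuE : (\int[circ]_t (u t * f t) =
    \int[circ]_t ((u t - v t) * f t) + \int[circ]_t ((v t - ab t) * f t)
    + \int[circ]_t (ab t * f t))%R.
  rewrite -RintegralD//; [|exact/continuous_circ_integrable/csub..].
  rewrite -RintegralD//; last 2 first.
  - apply: continuous_circ_integrable => t.
    by apply: cvgD; apply: csub.
  - exact/continuous_circ_integrable/continuous_mulf.
  by apply: eq_Rintegral => t _; ring.
have geom_le : `|(\int[circ]_t ((u t - v t) * f t))%R| <= 2 * pi * (g * B).
  apply: normr_Rintegral_circ_le; first exact/continuous_circ_integrable/csub.
  by apply/aeW => t; rewrite normrM ler_pM.
have rank_le : `|(\int[circ]_t ((v t - ab t) * f t))%R| <= 2 * pi * (e * B).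
  apply: normr_Rintegral_circ_le; first exact/continuous_circ_integrable/csub.
  by apply: (@filterS _ _ (ae_filter_ringOfSetsType circ)) ve => t vt; rewrite normrM ler_pM.
(* The discrete sums are exchanged so that the node values of [f], bounded by
   [B], factor out of the sum over the rank index. *)
pose net := \sum_(j < J) w j * f (x j) * \sum_(k < r) (a k * b k (x j) - ah k * bh k j).
have netE : net = \sum_(k < r) a k * (\sum_(j < J) w j * (b k (x j) * f (x j)))
    - \sum_(k < r) ah k * (\sum_(j < J) w j * bh k j * f (x j)).
  rewrite -sumrB /net; under eq_bigr do rewrite mulr_sumr.
  rewrite exchange_big /=; apply: eq_bigr => k _.
  rewrite !mulr_sumr -sumrB; apply: eq_bigr => j _; ring.
have net_le : `|net| <= B * \sum_(j < J) `|w j|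
      * \sum_(k < r) (`|b k (x j)| * da k + `|a k| * db k + da k * db k).
  apply: le_trans (ler_norm_sum _ _ _) _; rewrite mulr_sumr.
  apply: ler_sum => j _; rewrite !normrM mulrA [B * _]mulrC.
  apply: ler_pM => //; first by rewrite ler_wpM2l.
  apply: le_trans (ler_norm_sum _ _ _) _; apply: ler_sum => k _.
  exact: realization_term_le.
have quad_le : `|\sum_(k < r) a k * quad_err k| <= \sum_(k < r) `|a k| * `|quad_err k|.
  apply: le_trans (ler_norm_sum _ _ _) _.
  by apply: ler_sum => k _; rewrite normrM.
have -> : \sum_(k < r) ah k * (\sum_(j < J) w j * bh k j * f (x j))
      - (\int[circ]_t (u t * f t))%R =
    - ((\int[circ]_t ((u t - v t) * f t))%R + (\int[circ]_t ((v t - ab t) * f t))%R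
       + \sum_(k < r) a k * quad_err k + net).
  rewrite intuE intabE netE.
  rewrite (_ : \sum_(k < r) a k * quad_err k =
      \sum_(k < r) a k * (\int[circ]_t (b k t * f t))%R
      - \sum_(k < r) a k * (\sum_(j < J) w j * (b k (x j) * f (x j)))).
    by ring.
  by rewrite -sumrB; apply: eq_bigr => k _; rewrite /quad_err mulrBr.
rewrite normrN.
apply: le_trans (ler_normD _ _) _; apply: lerD => //.
apply: le_trans (ler_normD _ _) _; apply: lerD => //.
apply: le_trans (ler_normD _ _) _; rewrite addrC.
rewrite (_ : B * _ = 2 * pi * (e * B) + 2 * pi * (g * B)); last by ring.
exact: lerD.
Qed.

End pointwise_split.

(** * Error bounds from the finite-node assumptions *)

(** Lets the curve and its reconstruction be compared inside a single class,
    the only setting in which the kernel is known to be Lipschitz. *)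
Lemma curves_enlarge {R : realType} (n : nat) (M c0 c1 : R) X :
  0 < M -> 0 < c0 -> 0 < c1 ->
  curves n M c0 c1 X -> curves n (2 * M) (c0 / 2) (c1 / 2) X.
Proof.
move=> M0 c00 c10 [CX XM dX cX]; split=> //.
- by apply: le_trans XM _; rewrite lee_fin ler_peMl ?(ltW M0)// ler1n.
- move=> s; apply: le_trans (dX s); by rewrite ler_pdivrMr// ler_peMr ?(ltW c00)// ler1n.
- move=> s t; apply: le_trans (cX s t); rewrite ler_wpM2r//.
  by rewrite ler_pdivrMr// ler_peMr ?(ltW c10)// ler1n.
Qed.

Lemma node_itv {R : realType} (J : nat) (j : 'I_J) : 0 <= @node R J j < 2 * pi.
Proof.
have J0 : 0 < J%:R :> R by rewrite ltr0n (leq_ltn_trans _ (ltn_ord j)).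
rewrite /node !mulr_ge0 ?invr_ge0 ?pi_ge0//= ltr_pdivrMr//.
by rewrite ltr_pM2l ?ltr_nat// twopi_gt0.
Qed.

Section finite_node_error.
Context {R : realType}.
Variables (n : nat) (M c0 c1 : R) (D : ptopologicalType).
Variables (bdry : D -> R -> R) (geom : D -> R -> R * R).
Variable mu : probability (borel D) R.
Variables (r J : nat) (d : @node_data R r J).
Variable Nstar : (R -> R) -> (R -> R * R) -> R -> R.
Hypotheses (M0 : 0 < M) (c00 : 0 < c0) (c10 : 0 < c1) (J0 : (0 < J)%N).
Hypothesis geomA : forall p, curves n M c0 c1 (geom p).
Hypothesis dom : forall p, in_domain (geom p) (bdry p).
Hypothesis fn : finite_node n M c0 c1 bdry geom mu d Nstar.
Local Notation circ := (@circ R).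
Local Notation XJ p := (recon d J (geom p)).

Let B := nd_B d.

Section at_support_point.
Variable p : D.
Hypothesis sp : supp mu p.

Lemma input_le t : `|bdry p t| <= B.
Proof.
have [_ fB] := fn_input fn sp.
by rewrite -lee_fin; apply: le_trans fB; exact: fnorm_ge.
Qed.

Lemma input_bound_ge0 : 0 <= B.
Proof. by apply: le_trans (input_le 0). Qed.

Lemma recon_curve : curves n (2 * M) (c0 / 2) (c1 / 2) (XJ p).
Proof.
have [_ /(_ _ _ (geomA p) J0 (fn_rank fn).2)[]//] := fn_recon fn.
Qed.

Lemma kernel_geom_le s t :
  `|nd_ker d (geom p) s t - nd_ker d (XJ p) s t| <=
  nd_LR d * (nd_CPi d * J%:R ^- (n - nd_nu d) * M).
Proof.
have lip := ar_lip (fn_class_large fn) (curves_enlarge M0 c00 c10 (geomA p)) recon_curve.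
have LR0 := ar_LR (fn_class fn).
have [CPi0 /(_ _ _ (geomA p) J0 (fn_rank fn).2)[_ XXJ]] := fn_recon fn.
have [_ XM _ _] := geomA p.
rewrite -lee_fin; apply: le_trans (le_trans lip _).
  exact: (knorm_ge _ (fun s t => nd_ker d (geom p) s t - nd_ker d (XJ p) s t)).
rewrite EFinM; apply: lee_wpmul2l; first by rewrite lee_fin.
apply: le_trans XXJ _; rewrite [leRHS]EFinM; apply: lee_wpmul2l => //.
by rewrite lee_fin mulr_ge0// invr_ge0 exprn_ge0.
Qed.

Lemma kernel_rank_le : {ae circ, forall s, {ae circ, forall t,
  `|nd_ker d (XJ p) s t - \sum_(k < r) nd_a d k s * nd_b d k (XJ p) t| <=
  nd_Cker d * r%:R ^- nd_m d}}.
Proof.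
have [_ /(_ p sp)] := fn_lowrank fn.
rewrite unlock /=; case: ifPn => [_ /ess_supP rk|/negP[]]; last first.
  by rewrite -setXTT product_measure1E// mule_gt0// circT_gt0.
apply: (@product_circ_ae R (fun z => `|nd_ker d (XJ p) z.1 z.2
    - \sum_(k < r) nd_a d k z.1 * nd_b d k (XJ p) z.2| <= nd_Cker d * r%:R ^- nd_m d)).
case: rk => N [mN N0 gN]; exists N; split=> // z nz; apply: gN => /= rk; exact: nz.
Qed.

(** The quadrature rule is applied to the product of the branch function and
    the data, and its norm is split by the product inequality. *)
Lemma quad_error_le k :
  (`|(\int[circ]_t (nd_b d k (XJ p) t * bdry p t))%R
    - \sum_(j < J) nd_w d j * (nd_b d k (XJ p) (node j) * bdry p (node j))|%:E <=
  (nd_CQ d * nd_Cprod d * J%:R ^- nd_q d * B)%:E * fnorm (nd_q d) (nd_b d k (XJ p)))%E.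
Proof.
have [CQ0 quad] := fn_quad fn.
have [Cf fB] := fn_input fn sp.
have Cb := fn_branch fn k sp.
have Cp0 := product_constant_ge0 (fn_prod fn).
apply: le_trans (quad _ (CkT_mul Cb Cf)) _.
have J0' : 0 <= J%:R ^- nd_q d :> R by rewrite invr_ge0 exprn_ge0.
apply: (@le_trans _ _ ((nd_CQ d * J%:R ^- nd_q d)%:E *
    ((nd_Cprod d)%:E * fnorm (nd_q d) (nd_b d k (XJ p)) * B%:E)))%E.
  apply: lee_wpmul2l; first by rewrite lee_fin mulr_ge0.
  apply: le_trans (fn_prod fn Cb Cf) _.
  apply: lee_wpmul2l => //.
  by rewrite mule_ge0 ?fnorm_ge0 ?lee_fin.
rewrite [leRHS](_ : _ = (nd_CQ d * J%:R ^- nd_q d)%:E * ((nd_Cprod d)%:E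
  * fnorm (nd_q d) (nd_b d k (XJ p)) * B%:E))%E//.
rewrite !EFinM -!muleA; congr (_ * _)%E.
rewrite muleCA; congr (_ * _)%E; congr (_ * _)%E.
by rewrite muleC.
Qed.

(** A supremum over the support is nonnegative only if the support has a
    point, here [p]. *)
Lemma E_quad_ge0 : (0 <= E_quad geom mu d)%E.
Proof.
apply: (@le_trans _ _ ((nd_CQ d * nd_Cprod d * J%:R ^- nd_q d)%:E *
      \sum_(k < r) Linf_norm (nd_a d k)
                   * fnorm (nd_q d) (nd_b d k (XJ p))))%E; last first.
  by apply: ereal_sup_ubound; exists p.
rewrite mule_ge0 ?lee_fin ?mulr_ge0 ?invr_ge0 ?exprn_ge0//.
- by have [] := fn_quad fn.
- exact: product_constant_ge0 (fn_prod fn).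
- by apply: sume_ge0 => k _; rewrite mule_ge0 ?Linf_norm_ge0 ?fnorm_ge0.
Qed.

Lemma da_ge0 k : 0 <= nd_da d k.
Proof. exact: le_trans (fn_da fn k 0). Qed.

Lemma db_ge0 k : 0 <= nd_db d k.
Proof. exact: le_trans (fn_db fn sp k 0). Qed.

Let net_term k := (Linf_norm (nd_b d k (XJ p)) * (nd_da d k)%:E
  + Linf_norm (nd_a d k) * (nd_db d k)%:E + (nd_da d k * nd_db d k)%:E)%E.

Let net_term_ge0 k : (0 <= net_term k)%E.
Proof.
by rewrite !adde_ge0 ?mule_ge0 ?Linf_norm_ge0 ?lee_fin ?mulr_ge0 ?da_ge0 ?db_ge0.
Qed.

Lemma E_net_ge : ((\sum_(j < J) `|nd_w d j|)%:E * \sum_(k < r) net_term k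
  <= E_net geom mu d)%E.
Proof. by apply: ereal_sup_ubound; exists p. Qed.

Lemma E_net_ge0 : (0 <= E_net geom mu d)%E.
Proof.
apply: le_trans E_net_ge; rewrite mule_ge0//.
  by rewrite lee_fin sumr_ge0.
exact: sume_ge0.
Qed.

Lemma E_rank_ge0 : (0 <= E_rank d)%E.
Proof.
rewrite lee_fin !mulr_ge0 ?pi_ge0 ?invr_ge0 ?exprn_ge0//.
by have [] := fn_lowrank fn.
Qed.

Lemma E_geom_ge0 : (0 <= E_geom n M d)%E.
Proof.
rewrite lee_fin !mulr_ge0 ?pi_ge0 ?invr_ge0 ?exprn_ge0 ?(ltW M0)//.
- exact: ar_LR (fn_class fn).
- by have [] := fn_recon fn.
Qed.

Lemma quad_sum_le s : (forall k, (`|nd_a d k s|%:E <= Linf_norm (nd_a d k))%E) ->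
  ((\sum_(k < r) `|nd_a d k s| *
    `|(\int[circ]_t (nd_b d k (XJ p) t * bdry p t))%R
      - \sum_(j < J) nd_w d j * (nd_b d k (XJ p) (node j) * bdry p (node j))|)%:E
   <= B%:E * E_quad geom mu d)%E.
Proof.
move=> as_le.
apply: (@le_trans _ _ (B%:E * ((nd_CQ d * nd_Cprod d * J%:R ^- nd_q d)%:E *
      \sum_(k < r) Linf_norm (nd_a d k)
                   * fnorm (nd_q d) (nd_b d k (XJ p)))))%E; last first.
  apply: lee_wpmul2l; first by rewrite lee_fin input_bound_ge0.
  by apply: ereal_sup_ubound; exists p.
rewrite -sumEFin muleA -EFinM ge0_sume_distrr; last first.
  by move=> k _; rewrite mule_ge0 ?Linf_norm_ge0 ?fnorm_ge0.
apply: lee_sum => k _; rewrite [leLHS]EFinM muleCA.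
by apply: lee_pmul => //; rewrite [B * _]mulrC; exact: quad_error_le.
Qed.

Lemma net_sum_le s : (forall k, (`|nd_a d k s|%:E <= Linf_norm (nd_a d k))%E) ->
  ((B * \sum_(j < J) `|nd_w d j| * \sum_(k < r)
     (`|nd_b d k (XJ p) (node j)| * nd_da d k + `|nd_a d k s| * nd_db d k
      + nd_da d k * nd_db d k))%:E
   <= B%:E * E_net geom mu d)%E.
Proof.
move=> as_le; rewrite EFinM; apply: lee_wpmul2l.
  by rewrite lee_fin input_bound_ge0.
apply: le_trans E_net_ge; rewrite -!sumEFin ge0_sume_distrl//.
apply: lee_sum => j _; rewrite EFinM; apply: lee_wpmul2l => //.
rewrite -sumEFin; apply: lee_sum => k _.
rewrite !EFinD !EFinM; apply: leeD => //.
apply: leeD; apply: lee_pmul => //; rewrite ?lee_fin ?da_ge0 ?db_ge0//.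
apply: continuous_le_Linf_norm; last exact: node_itv.
exact: CkT_continuous (fn_branch fn k sp).
Qed.

(** The integral representation of the remainder, the rank bound and the trunk
    bounds hold for almost every [s]; at such an [s], [pointwise_split_le]
    applies and each of its terms is dominated by one error term times the
    bound [B] on the data. *)
Lemma finite_node_pointwise : {ae circ, forall s,
  (`|Nstar (bdry p) (geom p) s - remainder (geom p) (bdry p) s|%:E <=
   B%:E * (E_rank d + E_geom n M d + E_quad geom mu d + E_net geom mu d))%E}.
Proof.
have kerE := ar_kernel (fn_class fn) (geomA p) (dom p).
have trunk_ae : {ae circ, forall s, forall k,
    (`|nd_a d k s|%:E <= Linf_norm (nd_a d k))%E}.
  apply: (@filter_forall _ _ _ _ (ae_filter_ringOfSetsType circ)) => k.
  exact: Linf_norm_ae.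
apply: (@filterS3 _ _ (ae_filter_ringOfSetsType circ) _ _ _ _ _
  kerE kernel_rank_le trunk_ae) => s -> rk tk.
rewrite (fn_net fn sp).
have [CK _] := ar_bound (fn_class fn) (geomA p).
have [CKJ _] := ar_bound (fn_class_large fn) recon_curve.
have cK Y : CkT2 (nd_m d) (nd_ker d Y) -> continuous (nd_ker d Y s).
  by case=> _ _ /Ck2_continuous_slice; apply.
have [Cf _] := fn_input fn sp.
have key := @pointwise_split_le R r J (bdry p) (nd_ker d (geom p) s)
  (nd_ker d (XJ p) s) (fun k => nd_a d k s) (fun k => nd_ahat d k s)
  (nd_da d) (nd_db d) (fun k => nd_b d k (XJ p))
  (fun k j => nd_bhat d k (samples J (geom p)) (node j))
  (nd_w d) (@node R J) B _ _ (CkT_continuous Cf) (cK _ CK) (cK _ CKJ)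
  (fun k => CkT_continuous (fn_branch fn k sp)) input_le (kernel_geom_le s) rk
  (fun k => fn_da fn k s) (fun k j => fn_db fn sp k (node j)).
move: key; rewrite -lee_fin => /le_trans; apply.
have B0 : (0 <= B%:E)%E by rewrite lee_fin input_bound_ge0.
rewrite EFinD EFinD ge0_muleDr ?adde_ge0 ?E_rank_ge0 ?E_geom_ge0 ?E_quad_ge0 ?E_net_ge0//.
rewrite ge0_muleDr ?adde_ge0 ?E_rank_ge0 ?E_geom_ge0 ?E_quad_ge0//.
apply: leeD; last exact: net_sum_le.
apply: leeD; last exact: quad_sum_le.
rewrite -EFinD -EFinM lee_fin.
rewrite le_eqVlt; apply/orP; left; apply/eqP; ring.
Qed.

(** Passing from the almost everywhere bound to the L^2 norm costs the square
    root of the length of the circle. *)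
Lemma finite_node_model_error : L2T (Nstar (bdry p) (geom p)) ->
  (L2norm (fun s => Nstar (bdry p) (geom p) s - remainder (geom p) (bdry p) s)%R
   <= (Num.sqrt (2 * pi) * B)%:E
      * (E_rank d + E_geom n M d + E_quad geom mu d + E_net geom mu d))%E.
Proof.
move=> LN; have [Lr _] := fourier_remainder (dom p).
rewrite EFinM -muleA; apply: L2norm_le_sup finite_node_pointwise.
by apply: L2T_measurable (L2T_sub LN Lr).
Qed.

End at_support_point.
End finite_node_error.

Theorem theorem5p3 (R : realType) :
  exists C : R -> R,
  forall (n : nat) (M c0 c1 : R),
    (2 <= n)%N -> 0 < M -> 0 < c0 -> 0 < c1 ->
  forall (D : ptopologicalType) (bdry : D -> R -> R) (geom : D -> R -> R * R)
         (mu : probability (borel D) R),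
    @second_countable D ->
    (forall p, curves n M c0 c1 (geom p) /\ in_domain (geom p) (bdry p)) ->
  forall (r J : nat) (Theta : Type) (Th : set Theta)
         (tau : Theta -> 'I_r -> R -> R)
         (rho : Theta -> 'I_r -> (R -> R) -> ('I_J -> R * R) -> R),
    (0 < J)%N ->
    (forall th k, Th th -> L2T (tau th k)) ->
    (forall th, Th th ->
       measurable_fun [set: borel D]
         (model_error bdry geom (deeponet tau rho) th)) ->
  (forall (N : nat) (x : 'I_N -> D) (eta Edet : R) (thhat thstar : Theta),
     (0 < N)%N -> 0 <= eta -> Th thhat -> Th thstar ->
     (loss_emp bdry geom (deeponet tau rho) x thhat
        <= ereal_inf [set loss_emp bdry geom (deeponet tau rho) x th
                     | th in Th] + eta%:E)%E ->
     det_error bdry geom mu (deeponet tau rho) thstar Edet%:E ->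
     let bound := (Edet%:E
       + sqrte (2%:E * gen_gap bdry geom mu (deeponet tau rho) Th x)
       + (Num.sqrt eta)%:E)%E in
     [/\ (sqrte (loss_pop bdry geom mu (deeponet tau rho) thhat) <= bound)%E,
         (dtn_rms bdry geom mu (deeponet tau rho) W0 thhat <= bound)%E &
         forall K : nat,
           measurable_fun [set: borel D] (trunc_error bdry K) ->
           (dtn_rms bdry geom mu (deeponet tau rho) (W0_trunc K) thhat
              <= bound + sqrte (\int[mu]_(p in [set: borel D])
                                  (trunc_error bdry K p) ^+ 2))%E])
  /\
  (forall (d : node_data r J) (thstar : Theta),
     Th thstar ->
     finite_node n M c0 c1 bdry geom mu d (deeponet tau rho thstar) ->
     exists2 Edet : \bar R,
       det_error bdry geom mu (deeponet tau rho) thstar Edet &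
       (Edet <= (C (nd_B d))%:E
          * (E_rank d + E_geom n M d + E_quad geom mu d
             + E_net geom mu d))%E).
Proof.
exists (fun B => Num.sqrt (2 * pi) * B) => n M c0 c1 _ M0 c00 c10 D bdry geom mu scD
  adm r J Theta Th tau rho J0 Ltau merr; split.
  move=> N x eta Edet thhat thstar _ eta0 Thhat Thstar emin det bound.
  have dom p : in_domain (geom p) (bdry p) := (adm p).2.
  have LN p : L2T (deeponet tau rho thhat (bdry p) (geom p)).
    by apply: L2T_lincomb => k; exact: Ltau.
  have e0 : (0 <= Edet)%R by have [] := det.
  have pop_le : (sqrte (loss_pop bdry geom mu (deeponet tau rho) thhat) <= bound)%E.
    apply: (erm_sqrte_bound _ _ eta0 e0 Thhat Thstar emin).
    - by move=> th; exact: loss_pop_ge0.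
    - by move=> th; exact: loss_emp_ge0.
    - exact: loss_pop_det_error scD (merr _ Thstar) det.
  split=> //; first exact: le_trans (dtn_rms_le _ dom LN) pop_le.
  move=> K mtrunc.
  apply: le_trans (dtn_rms_trunc_le _ dom LN (merr _ Thhat) mtrunc) _.
  by rewrite leeD2r.
move=> d thstar Thstar fn.
have dom p : in_domain (geom p) (bdry p) := (adm p).2.
have geomA p : curves n M c0 c1 (geom p) := (adm p).1.
exists ((Num.sqrt (2 * pi) * nd_B d)%:E
  * (E_rank d + E_geom n M d + E_quad geom mu d + E_net geom mu d))%E => //.
have [p sp] := supp_nonempty mu scD.
split.
  rewrite mule_ge0 ?lee_fin ?mulr_ge0 ?sqrtr_ge0 ?(input_bound_ge0 fn sp)//.
  by rewrite !adde_ge0 ?(E_rank_ge0 fn) ?(E_geom_ge0 M0 fn) ?(E_quad_ge0 fn sp)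
    ?(E_net_ge0 fn sp).
apply: ge_ereal_sup => _ [q sq <-].
apply: (finite_node_model_error M0 c00 c10 J0 geomA dom fn sq).
by apply: L2T_lincomb => k; exact: Ltau.
Qed.
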